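(* Let $\Gamma$ be a countable group. The action $\Gamma \curvearrowright \mathrm{Ord}(\Gamma)$ has the specification property.
   Context: $\mathrm{Ord}(\Gamma)$ is the set of (strict) total orders on the set $\Gamma$ (irreflexive, transitive, any two distinct elements comparable in exactly one way), a compact metrizable space as a closed subset of $\{0,1\}^{\Gamma\times\Gamma}$ with the product topology. $\Gamma$ acts on it by homeomorphisms via $x\,(\gamma\cdot\prec)\,y \iff \gamma^{-1}x \prec \gamma^{-1}y$. An action $\Gamma\curvearrowright X$ by homeomorphisms on a compact metrizable space $X$ with compatible metric $d$ has the specification property if for every $\epsilon>0$ there exists a non-empty finite subset $F \subset \Gamma$ such that for every $x_1,x_2\in X$ and every $K \subset \Gamma$ there exists $x \in X$ with $d(g(x),g(x_1)) \le \epsilon$ for all $g\in K$ and $d(g(x),g(x_2))\le\epsilon$ for all $g \in \Gamma\setminus (FK)$, where $FK=\{fk: f\in F, k \in K\}$. (This property does not depend on the choice of the metric $d$.) *)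

(* Defs.v *)
From HB Require Import structures.
From mathcomp Require Import all_boot all_order all_algebra.
From mathcomp Require Import all_classical all_reals all_analysis.

Set Implicit Arguments.
Unset Strict Implicit.
Unset Printing Implicit Defensive.

Import Order.TTheory GRing.Theory Num.Theory.

Local Open Scope classical_set_scope.
Local Open Scope ring_scope.

Definition compatible_metric (R : realType) (X : topologicalType)
    (d : X -> X -> R) : Prop :=
  [/\ forall x y, 0 <= d x y,
      forall x y, d x y = 0 <-> x = y,
      forall x y, d x y = d y x,
      forall x y z, d x z <= d x y + d y z &
      forall (x : X) (A : set X),
        nbhs x A <-> exists2 e : R, 0 < e & [set y | d x y < e] `<=` A].

(* Each [act g] is a homeomorphism: its inverse is [act g^-1]. *)
Record action (G : groupType) (X : topologicalType) := Action {
  act :> G -> X -> X;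
  action1 : forall x, act 1%g x = x;
  actionM : forall g h x, act (g * h)%g x = act g (act h x);
  action_continuous : forall g, continuous (act g) }.

Definition specification_for (R : realType) (G : groupType)
    (X : topologicalType) (phi : action G X) (d : X -> X -> R) : Prop :=
  forall eps : R, 0 < eps ->
  exists F : set G, [/\ finite_set F, F !=set0 &
    forall (x1 x2 : X) (K : set G), exists x : X,
      (forall g, K g -> d (phi g x) (phi g x1) <= eps) /\
      (forall g, ~ [set (f * k)%g | f in F & k in K] g ->
        d (phi g x) (phi g x2) <= eps)].

(* On a compact metrizable space [specification_for phi d] does not depend on
   the compatible metric [d], whence the quantification over all of them.
   Meaningful for such [X] only: see [Ord_compact] and [Ord_metrizable]. *)
Definition specification_property (R : realType) (G : groupType)
    (X : topologicalType) (phi : action G X) : Prop :=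
  forall d : X -> X -> R, compatible_metric d -> specification_for phi d.

Definition strict_total_order (T : Type) (r : T * T -> bool) : Prop :=
  [/\ forall x, ~~ r (x, x),
      forall x y z, r (x, y) -> r (y, z) -> r (x, z) &
      forall x y, x <> y -> r (x, y) (+) r (y, x)].

(* [set_type] carries the topology induced by the inclusion in
   [{ptws T * T -> bool}], that is, {0,1}^(T x T) with the product topology. *)
Definition Ord (T : Type) : topologicalType :=
  set_type ([set r | strict_total_order r] : set {ptws T * T -> bool}).

Definition mkOrd (T : Type) (r : {ptws T * T -> bool})
    (rP : strict_total_order r) : Ord T :=
  exist (fun r => r \in _) r (mem_set rP).

Section Ord_topology.
Context {T : choiceType}.
Implicit Types (x y : Ord T) (A : set (Ord T)).

Lemma ptws_nbhsP (f : {ptws T * T -> bool}) (A : set {ptws T * T -> bool}) :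
  nbhs f A <->
  exists s : seq (T * T), [set h | forall i, i \in s -> h i = f i] `<=` A.
Proof.
pose B (s : seq (T * T)) : set {ptws T * T -> bool} :=
  [set h | forall i, i \in s -> h i = f i].
pose F := filter_from [set: seq (T * T)] B.
have FF : ProperFilter F.
  apply: filter_from_proper; last by move=> s _; exists f => i.
  apply: filter_from_filter; first by exists [::].
  move=> s t _ _; exists (s ++ t) => // h hst; split=> i i_s;
    by apply: hst; rewrite mem_cat i_s ?orbT.
split=> [fA|[s sA]].
  suff /(_ _ fA) [s _ sA] : F --> f by exists s.
  apply/cvg_sup => i; apply/cvg_image.
    by apply/seteqP; split=> // b _; exists (fun=> b).
  move=> W /= fW; exists [set h : {ptws T * T -> bool} | W (h i)].
    exists [:: i] => // h /(_ i); rewrite inE eqxx => /(_ isT) /= ->.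
    exact: nbhs_singleton fW.
  by apply/seteqP; split=> [b [h Wh <-]|b Wb] //; exists (fun=> b).
apply: filterS sA _; elim: s => [|j s IHs]; first exact: filterE.
have fj : nbhs f [set h : {ptws T * T -> bool} | h j = f j].
  by apply: (@proj_continuous _ (fun=> bool) j f [set f j]);
     exact: discrete_set1.
apply: filterS (filterI fj IHs) => h [hj hs] i; rewrite inE.
by case/orP=> [/eqP->|/hs].
Qed.

Lemma Ord_nbhsP x A :
  nbhs x A <-> exists s : seq (T * T),
    [set y | forall i, i \in s -> set_val y i = set_val x i] `<=` A.
Proof.
split=> [[/= _ [[W oW <-] Wx WA]]|[s sA]].
  have /ptws_nbhsP [s sW] : nbhs (set_val x) W by exact: open_nbhs_nbhs.
  by exists s => y /sW /WA.
have /(_ x) := @initial_continuous (Ord T) {ptws T * T -> bool} set_val.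
move=> /(_ [set h | forall i, i \in s -> h i = set_val x i]) xs.
by apply: filterS sA (xs _); apply/ptws_nbhsP; exists s.
Qed.

Lemma Ord_compact : compact [set: Ord T].
Proof.
pose S : set {ptws T * T -> bool} := [set r | strict_total_order r].
have cT : compact [set: {ptws T * T -> bool}].
  have := @tychonoff (T * T)%type (fun=> bool) (fun=> setT)
    (fun=> bool_compact).
  by congr compact; apply/seteqP; split.
have clS : closed S.
  move=> r clr.
  have agree (s : seq (T * T)) :
      exists2 h, strict_total_order h & forall i, i \in s -> h i = r i.
    have [|h [Sh hs]] := clr [set h | forall i, i \in s -> h i = r i].
      by apply/ptws_nbhsP; exists s.
    by exists h.
  split=> [a|a b c|a b ab].
  - have [h [h0 _ _] hE] := agree [:: (a, a)].
    by rewrite -hE ?inE ?eqxx.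
  - have [h [_ h0 _] hE] := agree [:: (a, b); (b, c); (a, c)].
    by rewrite -!hE ?inE ?eqxx ?orbT //; apply: h0.
  - have [h [_ _ h0] hE] := agree [:: (a, b); (b, a)].
    by rewrite -!hE ?inE ?eqxx ?orbT //; apply: h0.
have cS : compact S := subclosed_compact clS cT (@subsetT _ S).
move=> F FF _.
have /cS : ((set_val : Ord T -> {ptws T * T -> bool}) @ F) S.
  by apply: (@filterE _ F) => x; exact: set_valP.
case=> r [Sr clr]; exists (mkOrd Sr); split=> // A B FA.
case/Ord_nbhsP => s sB.
have [||h [[x Ax <-] hs]] := clr ((set_val : Ord T -> {ptws T * T -> bool}) @` A)
  [set h | forall i, i \in s -> h i = r i].
- by apply: (@filterS _ F _ A) FA => x Ax; exists x.
- by apply/ptws_nbhsP; exists s.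
- by exists x; split=> //; apply: sB.
Qed.

Lemma Ord_metrizable (R : realType) : countable [set: T] ->
  exists d : Ord T -> Ord T -> R, compatible_metric d.
Proof.
move=> /countable_injP[q qinj].
pose p (i : T * T) : nat := pickle (q i.1, q i.2).
have pinj : injective p.
  move=> [a b] [a' b'] /(pcan_inj pickleK) /= [qa qb].
  by congr pair; apply: qinj => //; rewrite inE.
pose D x y n := exists2 i, p i = n & set_val x i <> set_val y i.
have [d dP] : {d : Ord T -> Ord T -> R & forall x y,
    (d x y = 0 /\ x = y \/ exists2 n, D x y n & d x y = 2 ^- n) /\
    forall n, D x y n -> 2 ^- n <= d x y}.
  suff dxy x y : {e : R & (e = 0 /\ x = y \/ exists2 n, D x y n & e = 2 ^- n) /\
      forall n, D x y n -> 2 ^- n <= e}.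
    by exists (fun x y => projT1 (dxy x y)) => x y; case: (dxy x y).
  have [Dxy|nD] := pselect (exists n, `[< D x y n >]).
    case: (ex_minnP Dxy) => n /asboolP Dn nmin; exists (2 ^- n).
    split=> [|m /asboolP /nmin nm]; first by right; exists n.
    by rewrite lef_pV2 ?posrE ?exprn_gt0 // ler_weXn2l // ler1n.
  exists 0; split=> [|n Dn]; last by case: nD; exists n; apply/asboolP.
  left; split=> //; apply/val_inj/funext => i; apply: contrapT => xyi.
  by apply: nD; exists (p i); apply/asboolP; exists i.
have dn x y n : D x y n -> 2 ^- n <= d x y by have [_] := dP x y; apply.
have d_ge0 x y : 0 <= d x y.
  by have [[[->]|[n _ ->]] _] := dP x y; rewrite // invr_ge0 exprn_ge0.
have dle x y : d x y <= d y x.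
  have [[[-> _]|[n [i pi xyi] ->]] _] := dP x y; first exact: d_ge0.
  by apply: dn; exists i => // /esym.
exists d; split=> //.
- move=> x y; split=> [|->].
    have [[[_ ->]|[n _ ->]] _ /eqP] := dP x y => //.
    by rewrite invr_eq0 expf_eq0 pnatr_eq0 andbF.
  by have [[[-> _]|[n [i _ nyy] _]] _] := dP y y; last case: nyy.
- by move=> x y; apply/eqP; rewrite eq_le !dle.
- move=> x y z; have [[[-> _]|[n [i pi xzi] ->]] _] := dP x z.
    exact: addr_ge0.
  have [xyi|xyi] := eqVneq (set_val x i) (set_val y i).
    rewrite (le_trans (dn y z n _)) ?lerDr //.
    by exists i; rewrite // -xyi.
  rewrite (le_trans (dn x y n _)) ?lerDl //.
  by exists i => //; exact/eqP.
move=> x A; split=> [/Ord_nbhsP[s sA]|[e e0 eA]].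
  exists (2 ^- (\max_(i <- s) p i)); first by rewrite invr_gt0 exprn_gt0.
  move=> y /= dxy; apply: sA => i i_s; apply: contrapT => xyi.
  suff : 2 ^- (\max_(i <- s) p i) <= d x y by rewrite leNgt dxy.
  apply: (le_trans _ (dn x y (p i) _)); last by exists i => // /esym.
  rewrite lef_pV2 ?posrE ?exprn_gt0 // ler_weXn2l // ?ler1n //.
  exact: leq_bigmax_seq.
have [n ne] : exists n : nat, 2 ^- n < e.
  exists (Num.truncn e^-1).+1.
  rewrite invf_plt ?posrE ?exprn_gt0 //.
  apply: lt_le_trans (truncnS_gt _) _.
  by rewrite -natrX ler_nat ltnW // ltn_expl.
have /finite_seqP [s sE] : finite_set (p @^-1` `I_n.+1).
  by apply: finite_preimage; [move=> ? ? _ _; exact: pinj|exact: finite_II].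
apply/Ord_nbhsP; exists s => y ys; apply: eA => /=.
have [[[-> _]//|[m [i pi xyi] ->]] _] := dP x y.
apply: le_lt_trans ne.
rewrite lef_pV2 ?posrE ?exprn_gt0 // ler_weXn2l // ?ler1n //.
rewrite leqNgt; apply/negP => mn; apply: xyi; apply/esym/ys.
suff : [set` s] i by [].
by rewrite -sE /= pi ltnS ltnW.
Qed.

End Ord_topology.

Section Ord_action.
Context {G : groupType}.

Fact Ord_act_subproof (g : G) (r : Ord G) :
  strict_total_order
    (fun p : G * G => set_val r (g^-1 * p.1, g^-1 * p.2)%g).
Proof.
have [irr tr tot] := set_valP r; split=> [x|x y z|x y xy] /=.
- exact: irr.
- exact: tr.
- by apply: tot => /mulgI.
Qed.

Definition Ord_act (g : G) (r : Ord G) : Ord G :=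
  mkOrd (Ord_act_subproof g r).

Lemma Ord_actE g r x y :
  set_val (Ord_act g r) (x, y) = set_val r (g^-1 * x, g^-1 * y)%g.
Proof. by []. Qed.

Fact Ord_act1 r : Ord_act 1%g r = r.
Proof.
by apply/val_inj/funext => -[x y] /=; rewrite invg1 !mul1g.
Qed.

Fact Ord_actM g h r : Ord_act (g * h)%g r = Ord_act g (Ord_act h r).
Proof.
by apply/val_inj/funext => -[x y] /=; rewrite set_valE /= invgM !mulgA.
Qed.

Fact Ord_act_continuous g : continuous (Ord_act g).
Proof.
move=> r A /Ord_nbhsP [s sA]; apply/Ord_nbhsP.
exists [seq (g^-1 * p.1, g^-1 * p.2)%g | p <- s] => y ys.
apply: sA => -[a b] ab_s; rewrite !Ord_actE.
by apply: ys; apply/mapP; exists (a, b).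
Qed.

Definition Ord_action : action G (Ord G) :=
  Action Ord_act1 Ord_actM Ord_act_continuous.

End Ord_action.

(* Main.v *)
Require Import Defs.
From mathcomp Require Import all_boot all_order all_algebra.
From mathcomp Require Import all_classical all_reals all_analysis.

(** Two orders may be prescribed independently on disjoint sets: given a set
    [A], putting [A], ordered by [r1], below its complement, ordered by [r2],
    yields a total order again ([lex_sum]). Specification only asks for this.

    Indeed, compactness of the space of orders gives a finite set [S] of group
    elements such that orders agreeing on [S] are [eps]-close
    ([agree_on_finite_close]). The translate [g . r] agrees with [g . r1] on
    [S] as soon as [r] agrees with [r1] on [g^-1 S]. So the order sought must
    agree with [r1] on [g^-1 S] for [g] in [K], and with [r2] on [g^-1 S] for
    [g] outside [F K]. If [g^-1 a = k^-1 b] with [a], [b] in [S], then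
    [g = (a b^-1) k]; hence for [F = S S^-1] the two families of translates
    are disjoint, and the ordered sum over [A = K^-1 S] has both properties. *)

Set Implicit Arguments.
Unset Strict Implicit.
Unset Printing Implicit Defensive.

Import Order.TTheory GRing.Theory Num.Theory.

Local Open Scope classical_set_scope.
Local Open Scope ring_scope.

Section LexSum.
Context {T : Type} (A : set T) (r1 r2 : Ord T).

Definition lex_sum_rel (p : T * T) : bool :=
  if p.1 \in A then (p.2 \in A) ==> set_val r1 p
  else (p.2 \notin A) && set_val r2 p.

Lemma lex_sum_total_order : strict_total_order lex_sum_rel.
Proof.
have [irr1 tr1 tot1] := set_valP r1; have [irr2 tr2 tot2] := set_valP r2.
rewrite /lex_sum_rel; split=> [x|x y z|x y xy] /=.
- by case: (x \in A) => /=; [exact: irr1|exact: irr2].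
- case: (x \in A); case: (y \in A); case: (z \in A) => //=.
  + exact: tr1.
  + exact: tr2.
- case: (x \in A); case: (y \in A) => //=.
  + exact: tot1.
  + exact: tot2.
Qed.

Definition lex_sum : Ord T := mkOrd lex_sum_total_order.

Lemma lex_sumE p : set_val lex_sum p = lex_sum_rel p.
Proof. by []. Qed.

Lemma lex_sum_in x y : A x -> A y -> set_val lex_sum (x, y) = set_val r1 (x, y).
Proof. by move=> Ax Ay; rewrite lex_sumE /lex_sum_rel !mem_set. Qed.

Lemma lex_sum_notin x y :
  ~ A x -> ~ A y -> set_val lex_sum (x, y) = set_val r2 (x, y).
Proof. by move=> Ax Ay; rewrite lex_sumE /lex_sum_rel !memNset. Qed.

End LexSum.

(** Every order has a cylinder inside its ball of radius [eps / 2]; compactness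
    makes the finite set of constrained pairs uniform. It enters as a near
    covering argument along the filter of all sufficiently large finite sets
    of pairs. *)
Lemma agree_on_finite_close (R : realType) (T : choiceType)
    (d : Ord T -> Ord T -> R) (eps : R) :
  compatible_metric d -> 0 < eps ->
  exists S : seq T, forall x y : Ord T,
    (forall a b, a \in S -> b \in S -> set_val x (a, b) = set_val y (a, b)) ->
    d x y <= eps.
Proof.
move=> [_ _ dC dD dnbhs] eps_gt0.
pose close (s : seq (T * T)) (x : Ord T) := forall y : Ord T,
  (forall i, i \in s -> set_val y i = set_val x i) -> d x y <= eps.
pose large := filter_from [set: seq (T * T)]
  (fun s => [set t : seq (T * T) | {subset s <= t}]).
have large_filter : Filter large.
  apply: filter_from_filter; first by exists [::].
  move=> s t _ _; exists (s ++ t) => // u stu.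
  by split=> i i_s; apply: stu; rewrite mem_cat i_s ?orbT.
have near_close (x : Ord T) : [set: Ord T] x ->
    \forall x' \near x & s \near large, close s x'.
  move=> _; have /Ord_nbhsP [s sd] : nbhs x [set y | d x y < eps / 2].
    by apply/dnbhs; exists (eps / 2) => //; rewrite divr_gt0.
  exists ([set y | forall i, i \in s -> set_val y i = set_val x i],
          [set t : seq (T * T) | {subset s <= t}]).
    by split; [apply/Ord_nbhsP; exists s | exists s].
  move=> [x' t] /= [x's st] y yt.
  rewrite (le_trans (dD _ x _)) // [leRHS]splitr dC lerD // ltW //; apply: sd.
    exact: x's.
  by move=> i i_s; rewrite yt ?x's //; exact: st.
have /compact_near_coveringP /(_ _ large close large_filter near_close) :=
  @Ord_compact T.
case=> s _ /(_ s (fun _ => id)) close_s.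
exists ([seq i.1 | i <- s] ++ [seq i.2 | i <- s]) => x y xy.
apply: close_s => // -[a b] ab_s; rewrite xy // mem_cat.
  by apply/orP; left; apply/mapP; exists (a, b).
by apply/orP; right; apply/mapP; exists (a, b).
Qed.

Theorem proposition4p3 (R : realType) (G : groupType)
    (countableG : countable [set: G]) :
  specification_property R (@Ord_action G).
Proof.
move=> d dmetric eps eps_gt0.
have [S closeS] := agree_on_finite_close dmetric eps_gt0.
(* The element 1 only serves to make F nonempty when S is empty. *)
pose F := 1%g :: [seq (a * b^-1)%g | a <- S, b <- S].
exists [set` F]; split; first exact: finite_seq.
  by exists 1%g; rewrite /= mem_head.
move=> r1 r2 K.
pose A : set G := [set x | exists2 k, K k & (k * x)%g \in S].
exists (lex_sum A r1 r2); split=> g Hg; apply: closeS => a b aS bS;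
  rewrite !Ord_actE.
  by apply: lex_sum_in; exists g; rewrite // mulVKg.
have notA c : c \in S -> ~ A (g^-1 * c)%g.
  move=> cS [k Kk kcS]; apply: Hg.
  exists (c * (k * (g^-1 * c))^-1)%g; last first.
    by exists k => //; rewrite !invgM invgK !mulgA mulgV mul1g mulgVK.
  by rewrite /= inE; apply/orP; right; apply/allpairsP;
     exists (c, k * (g^-1 * c))%g.
by apply: lex_sum_notin; exact: notA.
Qed.
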